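(* Let $E=(E_1,E_2,E_3):\mathbb{R}^3\to\mathbb{C}^3$ satisfy the quasi-periodic condition $E(\mathbf{x}+\mathbf{a}_\ell)=e^{\imath 2\pi \mathbf{k}\cdot\mathbf{a}_\ell}E(\mathbf{x})$ for all $\mathbf{x}\in\mathbb{R}^3$ and $\ell=1,2,3$. Then, for $k=0,1,\dots,n_3-1$, $$E_1(\hat{0}:\hat{n}_1-1,\,n_2,\,k)=e^{\imath 2\pi\mathbf{k}\cdot\mathbf{a}_2}J_2\,E_1(\hat{0}:\hat{n}_1-1,\,0,\,k)$$ and $$E_3(0:n_1-1,\,n_2,\,\hat{k})=e^{\imath 2\pi\mathbf{k}\cdot\mathbf{a}_2}J_2\,E_3(0:n_1-1,\,0,\,\hat{k}),$$ where $$J_2=e^{\imath 2\pi\rho_1\mathbf{k}\cdot\mathbf{a}_1}\begin{bmatrix}0&e^{-\imath 2\pi\mathbf{k}\cdot\mathbf{a}_1}I_{m_1}\\ I_{n_1-m_1}&0\end{bmatrix}\in\mathbb{C}^{n_1\times n_1}.$$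
   Context: $\imath=\sqrt{-1}$; $\mathbf{k}\in\mathbb{R}^3$ is a fixed vector ($2\pi\mathbf{k}$ is the Bloch wave vector), not to be confused with the integer index $k$. The lattice translation vectors $\mathbf{a}_1,\mathbf{a}_2,\mathbf{a}_3\in\mathbb{R}^3$ are linearly independent and of the form $\mathbf{a}_1=(\|\mathbf{a}_1\|,0,0)^\top$, $\mathbf{a}_2=(\|\mathbf{a}_2\|\cos\theta_\gamma,\ \|\mathbf{a}_2\|\sin\theta_\gamma,\ 0)^\top$, $\mathbf{a}_3=(\|\mathbf{a}_3\|\cos\theta_\beta,\ \|\mathbf{a}_3\|\frac{\cos\theta_\alpha-\cos\theta_\gamma\cos\theta_\beta}{\sin\theta_\gamma},\ l_3)^\top$ with angles $\theta_\alpha,\theta_\beta,\theta_\gamma\in(0,\pi)$, $l_3=\|\mathbf{a}_3\|\frac{\sqrt{1-\cos^2\theta_\gamma-\cos^2\theta_\beta-\cos^2\theta_\alpha+2\cos\theta_\gamma\cos\theta_\beta\cos\theta_\alpha}}{\sin\theta_\gamma}>0$, and $\|\mathbf{a}_1\|\ge\|\mathbf{a}_2\|,\|\mathbf{a}_3\|$. Put $l_1=\|\mathbf{a}_1\|$, $l_2=\|\mathbf{a}_2\|\sin\theta_\gamma$; $n_1,n_2,n_3$ are positive integers and $\delta_x=l_1/n_1$, $\delta_y=l_2/n_2$, $\delta_z=l_3/n_3$. The lattice is adapted to the grid: there is an integer $0\le m_1\le n_1$ with $m_1=\frac{\|\mathbf{a}_2\|\cos\theta_\gamma}{\delta_x}$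 if $\cos\theta_\gamma\ge 0$ and $m_1=\frac{\|\mathbf{a}_1\|+\|\mathbf{a}_2\|\cos\theta_\gamma}{\delta_x}$ if $\cos\theta_\gamma<0$. Also $\rho_1=\lceil\frac{2\theta_\gamma}{\pi}-1\rceil$, i.e. $\rho_1=0$ if $0<\theta_\gamma\le\frac{\pi}{2}$ and $\rho_1=1$ if $\frac{\pi}{2}<\theta_\gamma<\pi$. For real $r,s,t$ put $\mathbf{x}(r,s,t)=(r\delta_x,s\delta_y,t\delta_z)^\top$ and $E_\ell(r,s,t)=E_\ell(\mathbf{x}(r,s,t))$. A hat on an index means a shift by one half: $\hat{i}=i+\tfrac12$, $\hat{k}=k+\tfrac12$. A colon range denotes the column vector of values: $E_3(0:n_1-1,n_2,\hat{k})=(E_3(i,n_2,\hat{k}))_{i=0}^{n_1-1}$ and $E_1(\hat{0}:\hat{n}_1-1,n_2,k)=(E_1(\hat{i},n_2,k))_{i=0}^{n_1-1}$. $I_m$ is the identity matrix of order $m$. *)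

(* Defs.v *)
From mathcomp Require Import all_boot all_order all_algebra.
From mathcomp Require Import all_classical all_reals all_analysis.
From mathcomp Require Import complex.

Set Implicit Arguments.
Unset Strict Implicit.
Unset Printing Implicit Defensive.

Import Order.TTheory GRing.Theory Num.Theory.

Local Open Scope ring_scope.
Local Open Scope complex_scope.

Definition vec3 (R : realType) (x y z : R) : 'cV[R]_3 :=
  \col_(i < 3) [:: x; y; z]`_i.

Definition dotp (R : realType) (u v : 'cV[R]_3) : R := (u^T *m v) 0 0.

(* The norm `|v| that MathComp-Analysis puts on matrices is the sup norm, so
   the Euclidean norm is defined here. *)
Definition enorm (R : realType) (v : 'cV[R]_3) : R := Num.sqrt (dotp v v).

(* expi t is e^(i t). *)
Definition expi (R : realType) (t : R) : R[i] := cos t +i* sin t.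

(* Num.sqrt is 0 on negative numbers; in a lattice (below) l3 is required to be
   positive, which forces the radicand to be positive. *)
Definition l3_formula (R : realType) (na3 ta tb tg : R) : R :=
  na3 * (Num.sqrt (1 - cos tg ^+ 2 - cos tb ^+ 2 - cos ta ^+ 2
                   + 2 * cos tg * cos tb * cos ta) / sin tg).

Record lattice (R : realType) := Lattice {
  vec_a1 : 'cV[R]_3;
  vec_a2 : 'cV[R]_3;
  vec_a3 : 'cV[R]_3;
  theta_alpha : R;
  theta_beta : R;
  theta_gamma : R;
  lattice_free : free [:: vec_a1; vec_a2; vec_a3];
  theta_alpha_range : 0 < theta_alpha < pi;
  theta_beta_range : 0 < theta_beta < pi;
  theta_gamma_range : 0 < theta_gamma < pi;
  vec_a1E : vec_a1 = vec3 (enorm vec_a1) 0 0;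
  vec_a2E : vec_a2 = vec3 (enorm vec_a2 * cos theta_gamma)
                          (enorm vec_a2 * sin theta_gamma) 0;
  vec_a3E : vec_a3 =
    vec3 (enorm vec_a3 * cos theta_beta)
         (enorm vec_a3 *
            ((cos theta_alpha - cos theta_gamma * cos theta_beta)
             / sin theta_gamma))
         (l3_formula (enorm vec_a3) theta_alpha theta_beta theta_gamma);
  l3_formula_gt0 :
    0 < l3_formula (enorm vec_a3) theta_alpha theta_beta theta_gamma;
  enorm_a2_le : enorm vec_a2 <= enorm vec_a1;
  enorm_a3_le : enorm vec_a3 <= enorm vec_a1
}.

Definition l1 (R : realType) (L : lattice R) : R := enorm (vec_a1 L).
Definition l2 (R : realType) (L : lattice R) : R :=
  enorm (vec_a2 L) * sin (theta_gamma L).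
Definition l3 (R : realType) (L : lattice R) : R :=
  l3_formula (enorm (vec_a3 L)) (theta_alpha L) (theta_beta L) (theta_gamma L).

Definition delta_x (R : realType) (L : lattice R) (n1 : nat) : R := l1 L / n1%:R.
Definition delta_y (R : realType) (L : lattice R) (n2 : nat) : R := l2 L / n2%:R.
Definition delta_z (R : realType) (L : lattice R) (n3 : nat) : R := l3 L / n3%:R.

Definition gridpt (R : realType) (L : lattice R) (n1 n2 n3 : nat) (r s t : R) :
    'cV[R]_3 :=
  vec3 (r * delta_x L n1) (s * delta_y L n2) (t * delta_z L n3).

(* The index l is 0-based: l = 0, 1, 2 gives the components E_1, E_2, E_3. *)
Definition grid_val (R : realType) (L : lattice R) (n1 n2 n3 : nat)
    (E : 'cV[R]_3 -> 'cV[R[i]]_3) (l : 'I_3) (r s t : R) : R[i] :=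
  E (gridpt L n1 n2 n3 r s t) l 0.

(* The hatted index. *)
Definition hat (R : realType) (i : nat) : R := i%:R + 2^-1.
Arguments hat {R} i.

Definition grid_adapted (R : realType) (L : lattice R) (n1 m1 : nat) : Prop :=
  m1%:R = if 0 <= cos (theta_gamma L)
          then enorm (vec_a2 L) * cos (theta_gamma L) / delta_x L n1
          else (enorm (vec_a1 L) + enorm (vec_a2 L) * cos (theta_gamma L))
               / delta_x L n1.

Definition rho1 (R : realType) (L : lattice R) : int :=
  Num.ceil (2 * theta_gamma L / pi - 1).

Definition quasi_periodic (R : realType) (L : lattice R) (kv : 'cV[R]_3)
    (E : 'cV[R]_3 -> 'cV[R[i]]_3) : Prop :=
  forall a : 'cV[R]_3, a \in [:: vec_a1 L; vec_a2 L; vec_a3 L] ->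
  forall x : 'cV[R]_3, E (x + a) = expi (2 * pi * dotp kv a) *: E x.

(* The block sizes are m1 and n1 - m1 for the rows but n1 - m1 and m1 for the
   columns, so both dimensions have to be cast to n1. *)
Definition J2 (R : realType) (L : lattice R) (kv : 'cV[R]_3) (n1 m1 : nat)
    (hm1 : (m1 <= n1)%N) : 'M[R[i]]_n1 :=
  expi (2 * pi * (rho1 L)%:~R * dotp kv (vec_a1 L)) *:
  castmx (subnKC hm1, subnK hm1)
    (block_mx (0 : 'M[R[i]]_(m1, n1 - m1))
              ((expi (- (2 * pi * dotp kv (vec_a1 L))))%:M : 'M[R[i]]_m1)
              (1%:M : 'M[R[i]]_(n1 - m1))
              (0 : 'M[R[i]]_(n1 - m1, m1))).

(* Main.v *)
Require Import Defs.
From mathcomp Require Import all_boot all_order all_algebra.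
From mathcomp Require Import all_classical all_reals all_analysis.
From mathcomp Require Import complex.
From mathcomp Require Import ring lra.

Import Order.TTheory GRing.Theory Num.Theory.

Local Open Scope ring_scope.
Local Open Scope complex_scope.

(** The points of the top face [s = n2] of the grid are translates of the
    bottom face [s = 0]. Because the lattice is adapted to the grid, the first
    coordinate of [a2] is [m1 * delta_x - rho1 * l1] whether the angle [theta_gamma] is
    obtuse or not, so that [a2 + rho1 * a1 = (m1 * delta_x, l2, 0)]
    ([shift_a2_rho1]) and

      [x(r, n2, t) = x(r - m1, 0, t) + a2 + rho1 * a1].

    Quasi-periodicity turns the two translations into the phases of [a2] and of
    [rho1 * a1]. With [r = i + h], where the offset [h] is [0] for [E_3] and
    [1/2] for [E_1], the shifted index [i - m1] is again a row index when
    [m1 <= i]: this is the identity block of [J2]. When [i < m1] it is negative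
    and a further translation by [a1 = (n1 * delta_x, 0, 0)] brings it back to
    [i + (n1 - m1)], at the price of the phase [e^(- i 2 pi k.a1)]: this is the
    other block. So [J2] acts as a twisted cyclic shift ([cyclic_block_mulE]).
*)

Lemma expiD (R : realType) (s t : R) : expi (s + t) = expi s * expi t.
Proof. by rewrite /expi cosD sinD; apply/eqP; rewrite eq_complex /= eqxx addrC eqxx. Qed.

Lemma expi0 (R : realType) : expi (0 : R) = 1.
Proof. by rewrite /expi cos0 sin0. Qed.

(** Row [i] of this matrix is supported on a single column, [i + p] or
    [i - m]. Taking both block sizes [m] and [p] as free naturals lets the row
    equation be eliminated, so that only the columns carry a cast. *)
Lemma cyclic_block_mulE (K : nzRingType) (m p n : nat) (er : (m + p = n)%N)
    (ec : (p + m = n)%N) (c : K) (f : nat -> K) (i : 'I_n) :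
  (castmx (er, ec) (block_mx (0 : 'M[K]_(m, p)) c%:M 1%:M (0 : 'M[K]_(p, m)))
     *m \col_(j < n) f j) i 0
  = if (i < m)%N then c * f (i + p)%N else f (i - m)%N.
Proof.
case: _ / er ec i => ec i.
rewrite mxE (reindex (cast_ord ec)) /=; last first.
  by exists (cast_ord (esym ec)) => j _; rewrite ?cast_ordK ?cast_ordKV.
rewrite big_split_ord /=.
case: (split_ordP i) => i0 ->.
- rewrite big1 ?add0r; last first.
    by move=> j _; rewrite castmxE /= cast_ordK cast_ord_id block_mxEul !mxE mul0r.
  rewrite (bigD1 i0) //= big1 ?addr0; last first.
    move=> j /negPf ji; rewrite castmxE /= cast_ordK cast_ord_id block_mxEur !mxE.
    by rewrite eq_sym ji mulr0n mul0r.
  rewrite castmxE /= cast_ordK cast_ord_id block_mxEur !mxE eqxx mulr1n /=.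
  by rewrite addnC.
- rewrite [X in _ + X]big1 ?addr0; last first.
    by move=> j _; rewrite castmxE /= cast_ordK cast_ord_id block_mxEdr !mxE mul0r.
  rewrite (bigD1 i0) //= big1 ?addr0; last first.
    move=> j /negPf ji; rewrite castmxE /= cast_ordK cast_ord_id block_mxEdl !mxE.
    by rewrite eq_sym ji mulr0n mul0r.
  rewrite castmxE /= cast_ordK cast_ord_id block_mxEdl !mxE eqxx mulr1n mul1r /=.
  by rewrite addKn.
Qed.

Lemma vec3D (R : realType) (x y z x' y' z' : R) :
  vec3 x y z + vec3 x' y' z' = vec3 (x + x') (y + y') (z + z').
Proof. by apply/colP => -[[|[|[|[]]]] ?] //; rewrite !mxE. Qed.

Lemma l1_neq0 (R : realType) (L : lattice R) : l1 L != 0.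
Proof.
apply/eqP => l10.
have /eqP[] : vec_a1 L != 0 by apply: (free_not0 (lattice_free L)); rewrite inE eqxx.
by rewrite vec_a1E -/(l1 L) l10; apply/colP => -[[|[|[|[]]]] ?] //; rewrite !mxE.
Qed.

(** [2 theta_gamma / pi - 1] lies in [(-1, 1)], and the sign of the cosine
    decides between its two possible ceilings. *)
Lemma rho1E (R : realType) (L : lattice R) :
  rho1 L = if 0 <= cos (theta_gamma L) then 0 else 1.
Proof.
have /andP[g0 gpi] := theta_gamma_range L.
have pi0 := pi_gt0 R.
rewrite /rho1; set t := theta_gamma L in g0 gpi *.
have [tpi|tpi] := leP t (pi / 2).
- have -> : 0 <= cos t by apply: cos_ge0_pihalf; apply/andP; split; lra.
  apply/eqP; rewrite Num.Theory.ceil_eq sub0r mulr0z mulrN1z; apply/andP; split.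
    by rewrite ltrBrDr addNr divr_gt0 ?mulr_gt0.
  by rewrite subr_le0 ler_pdivrMr //; lra.
- have ct : cos t < 0.
    have -> : t = (t - pi) + pi by rewrite subrK.
    by rewrite cosDpi oppr_lt0; apply: cos_gt0_pihalf; apply/andP; split; lra.
  rewrite leNgt ct /=.
  apply/eqP; rewrite Num.Theory.ceil_eq subrr mulr0z mulr1z; apply/andP; split.
    by rewrite subr_gt0 ltr_pdivlMr //; lra.
  by rewrite lerBlDr ler_pdivrMr //; lra.
Qed.

(** The [+ |a1|] in the obtuse case of [grid_adapted] is exactly the [rho1 * a1]
    on the left, so both cases give the same formula. *)
Lemma shift_a2_rho1 (R : realType) (L : lattice R) (n1 m1 : nat) :
  (0 < n1)%N -> grid_adapted L n1 m1 ->
  vec_a2 L + vec_a1 L *~ rho1 L = vec3 (m1%:R * delta_x L n1) (l2 L) 0.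
Proof.
move=> n1_gt0 m1E.
have d0 : delta_x L n1 != 0.
  by rewrite mulf_neq0 ?l1_neq0 // invr_neq0 // pnatr_eq0 -lt0n.
rewrite vec_a2E vec_a1E -/(l2 L) rho1E m1E.
case: ifP => _; rewrite divfK //.
- by rewrite mulr0z addr0.
- by rewrite mulr1z vec3D !addr0 addrC.
Qed.

Lemma gridpt_addn1 (R : realType) (L : lattice R) (n1 n2 n3 : nat)
    (n1_gt0 : (0 < n1)%N) (r s t : R) :
  gridpt L n1 n2 n3 (r + n1%:R) s t = gridpt L n1 n2 n3 r s t + vec_a1 L.
Proof.
rewrite vec_a1E /gridpt vec3D !addr0 mulrDl; congr (vec3 (_ + _) _ _).
by rewrite /delta_x mulrC divfK // pnatr_eq0 -lt0n.
Qed.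

Lemma gridpt_addm1 (R : realType) (L : lattice R) (n1 n2 n3 m1 : nat)
    (n1_gt0 : (0 < n1)%N) (n2_gt0 : (0 < n2)%N) (m1E : grid_adapted L n1 m1)
    (r t : R) :
  gridpt L n1 n2 n3 (r + m1%:R) n2%:R t
  = gridpt L n1 n2 n3 r 0 t + vec_a2 L + vec_a1 L *~ rho1 L.
Proof.
rewrite -addrA (shift_a2_rho1 _ _ _ _ n1_gt0 m1E) /gridpt vec3D mul0r add0r addr0 mulrDl.
congr (vec3 _ _ _).
by rewrite /delta_y mulrC divfK // pnatr_eq0 -lt0n.
Qed.

Lemma quasi_periodic_rho1 (R : realType) (L : lattice R) (kv : 'cV[R]_3)
    (E : 'cV[R]_3 -> 'cV[R[i]]_3) (hE : quasi_periodic L kv E)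
    (x : 'cV[R]_3) :
  E (x + vec_a1 L *~ rho1 L)
  = expi (2 * pi * (rho1 L)%:~R * dotp kv (vec_a1 L)) *: E x.
Proof.
rewrite rho1E; case: ifP => _.
- by rewrite !mulr0z mulr0 mul0r expi0 scale1r addr0.
- by rewrite !mulr1z mulr1 hE // !inE eqxx.
Qed.

(** The common form of both identities: [h] is the offset of the first grid
    coordinate, [0] or [1/2]. *)
Lemma grid_val_top_face (R : realType) (L : lattice R) (kv : 'cV[R]_3)
    (n1 n2 n3 : nat) (n1_gt0 : (0 < n1)%N) (n2_gt0 : (0 < n2)%N)
    (m1 : nat) (hm1 : (m1 <= n1)%N) (m1E : grid_adapted L n1 m1)
    (E : 'cV[R]_3 -> 'cV[R[i]]_3) (hE : quasi_periodic L kv E)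
    (l : 'I_3) (h t : R) :
  \col_(i < n1) grid_val L n1 n2 n3 E l (i%:R + h) n2%:R t
  = expi (2 * pi * dotp kv (vec_a2 L)) *:
    (J2 L kv hm1 *m \col_(i < n1) grid_val L n1 n2 n3 E l (i%:R + h) 0 t).
Proof.
apply/colP => i; rewrite /J2 -scalemxAl 3!mxE.
rewrite (cyclic_block_mulE _ _ _ _ _ _ _
  (fun j : nat => grid_val L n1 n2 n3 E l (j%:R + h) 0 t)).
have top r : grid_val L n1 n2 n3 E l (r + m1%:R) n2%:R t
    = expi (2 * pi * dotp kv (vec_a2 L))
      * (expi (2 * pi * (rho1 L)%:~R * dotp kv (vec_a1 L))
         * grid_val L n1 n2 n3 E l r 0 t).
  rewrite /grid_val gridpt_addm1 // (quasi_periodic_rho1 _ _ _ _ hE) hE ?inE ?eqxx ?orbT //.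
  by rewrite !mxE mulrCA.
have -> : i%:R + h = (i%:R + h - m1%:R) + m1%:R by rewrite subrK.
rewrite top; congr (_ * (_ * _)).
case: (ltnP i m1) => im.
- have -> : (i + (n1 - m1))%:R + h = (i%:R + h - m1%:R) + n1%:R.
    by rewrite natrD natrB //; ring.
  rewrite /grid_val gridpt_addn1 // hE ?inE ?eqxx // [in RHS]mxE mulrA -expiD.
  by rewrite addNr expi0 mul1r.
- by rewrite natrB // addrAC.
Qed.

Theorem theorem3p2 (R : realType) (L : lattice R) (kv : 'cV[R]_3)
    (n1 n2 n3 : nat) (n1_gt0 : (0 < n1)%N) (n2_gt0 : (0 < n2)%N)
    (n3_gt0 : (0 < n3)%N) (m1 : nat) (hm1 : (m1 <= n1)%N)
    (m1E : grid_adapted L n1 m1)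
    (E : 'cV[R]_3 -> 'cV[R[i]]_3) (hE : quasi_periodic L kv E)
    (k : nat) (hk : (k < n3)%N) :
  (\col_(i < n1) grid_val L n1 n2 n3 E 0 (hat i) n2%:R k%:R
   = expi (2 * pi * dotp kv (vec_a2 L)) *:
     (J2 L kv hm1 *m
      \col_(i < n1) grid_val L n1 n2 n3 E 0 (hat i) 0 k%:R))
  /\
  (\col_(i < n1) grid_val L n1 n2 n3 E 2 i%:R n2%:R (hat k)
   = expi (2 * pi * dotp kv (vec_a2 L)) *:
     (J2 L kv hm1 *m
      \col_(i < n1) grid_val L n1 n2 n3 E 2 i%:R 0 (hat k))).
Proof.
split; first exact: grid_val_top_face.
have noshift s : \col_(i < n1) grid_val L n1 n2 n3 E 2 i%:R s (hat k)
    = \col_(i < n1) grid_val L n1 n2 n3 E 2 (i%:R + 0) s (hat k).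
  by apply/colP => i; rewrite !mxE addr0.
by rewrite !noshift; exact: grid_val_top_face.
Qed.
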